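(* Let $n\ge1$, $k\ge2$, and let $P(\lambda)=\sum_{j=0}^k\lambda^jA_j$, $A_j\in\mathbb{R}^{n\times n}$, be a $T$-skew-symmetric matrix polynomial (i.e. $A_j^T=-A_j$ for all $j$) with $A_k$ nonsingular, all of whose eigenvalues are semi-simple. Let $(X,J)\in\mathbb{R}^{n\times kn}\times\mathbb{R}^{kn\times kn}$ be a real standard pair of $P(\lambda)$ with $X=[X_1,\ldots,X_s]$, $J=\mathrm{diag}(J_1,\ldots,J_s)$, where $$J_j=\begin{bmatrix} \alpha_jI_{n_j} & \beta_jI_{n_j} \\ -\beta_jI_{n_j} & \alpha_jI_{n_j} \end{bmatrix}\ (j=1,\ldots,r),\qquad J_j=\alpha_jI_{n_j}\ (j=r+1,\ldots,s),$$ with $\alpha_j\in\mathbb{R}$, $\beta_j\in\mathbb{R}\setminus\{0\}$, and the spectra of $J_1,\ldots,J_s$ pairwise disjoint. Then the algebraic multiplicity $n_j$ of each eigenvalue $\lambda_j$ is even, $n_j=2m_j$ with $m_j$ a positive integer, $j=1,\ldots,s$, and there exists a real standard pair $(\tilde X,J)$ of $P(\lambda)$ such that the corresponding matrix $\tilde\Gamma\in\mathcal{S}_{(J,T,-1,-1)}$ has the structure $$\tilde\Gamma=\mathrm{diag}\Big(G_1,\ldots,G_r,\begin{bmatrix} 0 & I_{m_{r+1}} \\ -I_{m_{r+1}} & 0 \end{bmatrix},\ldots,\begin{bmatrix} 0 & I_{m_s} \\ -I_{m_s} & 0 \end{bmatrix}\Big),\quad G_j=\mathrm{diag}\Big(\begin{bmatrix}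 0 & E_{m_j} \\ -E_{m_j} & 0 \end{bmatrix},\begin{bmatrix} 0 & -E_{m_j} \\ E_{m_j} & 0 \end{bmatrix}\Big),$$ where each $E_{m_j}=\mathrm{diag}(\pm1,\ldots,\pm1)$ is $m_j\times m_j$, $j=1,\ldots,r$.
   Context: $(X,J)$ is a standard pair of $P$ if the matrix $X_L$ obtained by stacking $X,XJ,\ldots,XJ^{k-1}$ (top to bottom) is nonsingular and $\sum_{i=0}^kA_iXJ^i=0$. An eigenvalue is semi-simple if its algebraic and geometric multiplicities coincide. Here $\lambda_j=\alpha_j+\mathrm{i}\beta_j$ for $j\le r$ and $\lambda_j=\alpha_j$ for $j>r$. $\mathcal{S}_{(J,T,-1,-1)}=\{S\in\mathbb{R}^{kn\times kn}:S^T=-S,\ SJ^T=JS\}$. The matrix corresponding to a standard pair $(X,J)$ of $P$ is $\Gamma=(X_L^T\mathcal{A}X_L)^{-1}$, where $\mathcal{A}\in\mathbb{R}^{kn\times kn}$ is the $k\times k$ block matrix whose $(p,q)$ block is $A_{p+q-1}$ if $p+q\le k+1$ and $0$ otherwise. *)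

(* Defs.v *)
From mathcomp Require Import all_boot all_order all_algebra.
From mathcomp Require Import reals complex.

Set Implicit Arguments.
Unset Strict Implicit.
Unset Printing Implicit Defensive.

Import GRing.Theory Num.Theory.
Local Open Scope ring_scope.

Section MatrixPolynomials.
Variables (R : realType) (n k : nat).
(* P(lambda) = \sum_(j <= k) lambda^j A_j, given by its coefficients. *)
Variable A : 'I_k.+1 -> 'M[R]_n.

Definition T_skew_symmetric : Prop := forall j, (A j)^T = - A j.

Definition mpoly_cmx : 'M[{poly R[i]}]_n :=
  \sum_(j < k.+1) 'X^j *: map_mx (fun a => ((real_complex R a)%:P)) (A j).

Definition mpoly_eval (z : R[i]) : 'M[R[i]]_n :=
  \sum_(j < k.+1) z ^+ j *: map_mx (real_complex R) (A j).

(* There are no eigenvalues at infinity when A_k is nonsingular. *)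
Definition mpoly_eigenvalue (z : R[i]) : bool := root (\det mpoly_cmx) z.

Definition alg_mult (z : R[i]) : nat := mup z (\det mpoly_cmx).

(* kermx is a left kernel; the transpose gives {x | P(z) x = 0}. *)
Definition geo_mult (z : R[i]) : nat := \rank (kermx (mpoly_eval z)^T).

Definition semisimple_eigenvalues : Prop :=
  forall z, mpoly_eigenvalue z -> alg_mult z = geo_mult z.

Lemma sum_nat_block : (\sum_(i < k) n = k * n)%N.
Proof. by rewrite sum_nat_const card_ord. Qed.

Definition stack_XJ (X : 'M[R]_(n, k * n)) (J : 'M[R]_(k * n)) :
    'M[R]_(k * n) :=
  castmx (sum_nat_block, erefl) (\mxcol_(i < k) (X *m J ^+ i)).

Definition standard_pair (X : 'M[R]_(n, k * n)) (J : 'M[R]_(k * n)) : Prop :=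
  stack_XJ X J \in unitmx /\
  \sum_(i < k.+1) A i *m X *m J ^+ i = 0.

(* With indices starting at 0, block (p, q) is A_(p+q+1) if p + q < k. *)
Definition hankel_coef : 'M[R]_(k * n) :=
  castmx (sum_nat_block, sum_nat_block)
    (\mxblock_(p < k, q < k)
       (if (p + q < k)%N then A (inord (p + q).+1) else 0)).

Definition pair_Gamma (X : 'M[R]_(n, k * n)) (J : 'M[R]_(k * n)) :
    'M[R]_(k * n) :=
  invmx ((stack_XJ X J)^T *m hankel_coef *m stack_XJ X J).

End MatrixPolynomials.

(* Membership in S_(J,T,-1,-1). *)
Definition S_JTmm (R : realType) (N : nat) (J S : 'M[R]_N) : Prop :=
  S^T = - S /\ S *m J^T = J *m S.

(* Real size of a block attached to an eigenvalue of multiplicity d;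
   b tells whether the eigenvalue is non-real. *)
Definition bdim (b : bool) (d : nat) : nat := if b then (d + d)%N else d.

Definition J_block (R : realType) (b : bool) (d : nat) (alpha beta : R) :
    'M[R]_(bdim b d) :=
  match b return 'M[R]_(bdim b d) with
  | true => block_mx alpha%:M beta%:M (- beta)%:M alpha%:M
  | false => alpha%:M
  end.

Definition sign_mx (R : realType) (m : nat) (e : 'I_m -> bool) : 'M[R]_m :=
  diag_mx (\row_i (-1) ^+ e i).

Definition skew_block (R : realType) (m : nat) (E : 'M[R]_m) : 'M[R]_(m + m) :=
  block_mx 0 E (- E) 0.

Definition Gamma_block (R : realType) (b : bool) (m : nat) (e : 'I_m -> bool) :
    'M[R]_(bdim b (m + m)) :=
  match b return 'M[R]_(bdim b (m + m)) with
  | true => block_mx (skew_block (sign_mx R e)) 0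
                     0 (skew_block (- sign_mx R e))
  | false => skew_block 1%:M
  end.

Definition spectrum (R : realType) (d : nat) (M : 'M[R]_d) : pred R[i] :=
  eigenvalue (map_mx (real_complex R) M).

(* Main.v *)
Require Import Defs.
From mathcomp Require Import all_boot all_order all_algebra.
From mathcomp Require Import reals complex.
From mathcomp Require boolp.
From mathcomp Require Import ring.

Set Implicit Arguments.
Unset Strict Implicit.
Unset Printing Implicit Defensive.

Import GRing.Theory Num.Theory.
Local Open Scope ring_scope.

(** Let [H] be the block Hankel matrix of the coefficients.  Skew-symmetry makes
    the Gram matrix [M = X_L^T H X_L] skew-symmetric with [M J = J^T M], so
    [Gamma = M^-1] is skew and satisfies [Gamma J^T = J Gamma].  Since the blocks
    of [J] have disjoint spectra, [Gamma] is block diagonal.  A block attached to a real eigenvalue is a nonsingular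
    real alternating form; a block attached to a pair of non-real eigenvalues has
    the shape [[P, Q], [Q, -P]] and is the real form of the nonsingular complex
    alternating form [P - iQ].  Both have even rank and a symplectic basis, and the
    corresponding change of basis [T] commutes with [J], so that [X T^-1] is again a
    standard pair with [Gamma] replaced by [T Gamma T^T].  Over the complex numbers
    all signs can be normalised to [+1].  Finally [Y |-> Y X^T] identifies
    [ker (J - z)] with [ker P(z)], so the geometric multiplicity of [lambda_j] is
    [n_j]; by semi-simplicity this is also its algebraic multiplicity. *)

(** * Symplectic bases of alternating forms *)

Definition symp_mx (R : pzRingType) m : 'M[R]_(m + m) := block_mx 0 1%:M (- 1%:M) 0.

Section SymplecticBasis.
Variable F : fieldType.
Hypothesis char2 : (2 : F) != 0.

Lemma skew_mx11 (S : 'M[F]_1) : S^T = - S -> S = 0.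
Proof.
move=> /matrixP/(_ 0 0); rewrite !mxE => S00.
have /eqP : 2 * S 0 0 = 0 by rewrite mulr_natl mulr2n {2}S00 subrr.
rewrite mulf_eq0 (negPf char2) /= => /eqP S00_0.
by apply/matrixP => i j; rewrite !ord1 S00_0 mxE.
Qed.

(** The rows of [U] and [V] are the two halves of a partial symplectic basis, kept apart so that an
    extension appends one row to each. *)
Definition symplectic_family n m (S : 'M[F]_n) (U V : 'M[F]_(m, n)) :=
  [/\ U *m S *m U^T = 0, V *m S *m V^T = 0 & U *m S *m V^T = 1%:M].

Lemma skew_congr p q n (S : 'M[F]_n) (U : 'M[F]_(p, n)) (V : 'M[F]_(q, n)) :
  S^T = - S -> V *m S *m U^T = - (U *m S *m V^T)^T.
Proof. by move=> St; rewrite !trmx_mul trmxK St mulNmx mulmxN mulmxA opprK. Qed.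

Lemma symplectic_family_gram n m (S : 'M[F]_n) (U V : 'M[F]_(m, n)) :
  S^T = - S -> symplectic_family S U V ->
  col_mx U V *m S *m (col_mx U V)^T = symp_mx F m.
Proof.
move=> St [UU VV UV]; rewrite mul_col_mx tr_col_mx mul_col_row UU VV UV.
by rewrite (skew_congr _ _ St) UV trmx1.
Qed.

Lemma symp_mx_unit m : symp_mx F m \in unitmx.
Proof.
have : symp_mx F m *m - symp_mx F m = 1%:M.
  rewrite mulmxN mulmx_block !(mul0mx, mulmx0, mulmx1, mul1mx, add0r, addr0).
  by rewrite opp_block_mx !opprK !oppr0 -scalar_mx_block.
by move=> /mulmx1_unit[].
Qed.

(** The nonsingular Gram matrix of size [m + m] factors through a space of dimension [n]. *)
Lemma symplectic_family_le n m (S : 'M[F]_n) (U V : 'M[F]_(m, n)) :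
  S^T = - S -> symplectic_family S U V -> (m + m <= n)%N.
Proof.
move=> St /(symplectic_family_gram St) E.
rewrite -(mxrank_unit (symp_mx_unit m)) -E.
apply: leq_trans (mxrankM_maxl _ _) _.
by apply: leq_trans (mxrankM_maxr _ _) _; rewrite rank_leq_row.
Qed.

(** A symplectic Gram-Schmidt step: since [m + m < n], some nonzero [x] is [S]-orthogonal to the
    family, and nonsingularity of [S] provides a partner [y] for it. *)
Lemma symplectic_extend n m (S : 'M[F]_n) (U V : 'M[F]_(m, n)) :
  S^T = - S -> S \in unitmx -> (m + m < n)%N -> symplectic_family S U V ->
  exists (U' V' : 'M[F]_(m.+1, n)), symplectic_family S U' V'.
Proof.
move=> St Su lt_mn [UU VV UV].
have [x /sub_kermxP xW x0] : exists2 x : 'rV_n,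
    (x <= kermx (S *m (col_mx U V)^T))%MS & x != 0.
  apply/rowV0Pn; rewrite -mxrank_eq0 mxrank_ker subn_eq0 -ltnNge.
  exact: leq_ltn_trans (rank_leq_col _) lt_mn.
move: xW; rewrite tr_col_mx mul_mx_row mul_mx_row !mulmxA => xW.
have [xU xV] : x *m S *m U^T = 0 /\ x *m S *m V^T = 0.
  by apply: (@eq_row_mx _ 1 m m); rewrite xW row_mx0.
have [j xSj] : exists j, (x *m S) 0 j != 0.
  by apply/rV0Pn; apply: contra x0 => /eqP xS; rewrite -(mulmxK Su x) xS mul0mx.
pose y0 : 'rV[F]_n := ((x *m S) 0 j)^-1 *: delta_mx 0 j.
have xy0 : x *m S *m y0^T = 1%:M.
  rewrite linearZ /= -scalemxAr trmx_delta -colE.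
  by rewrite [col _ _]mx11_scalar [col _ _ 0 0]mxE scale_scalar_mx mulVf.
(* This subtracts from [y0] its symplectic projection onto the rows of [U] and [V]; the opposite
   signs reflect [V S U^T = -1]. As [x] is orthogonal to those rows, its pairing with [y] stays
   1. *)
pose y := y0 - y0 *m S *m V^T *m U + y0 *m S *m U^T *m V.
have VU : V *m S *m U^T = - 1%:M by rewrite (skew_congr _ _ St) UV trmx1.
have yU : y *m S *m U^T = 0.
  move: UU VU; rewrite -!mulmxA /y !(mulmxDl, mulNmx) -!mulmxA => -> ->.
  by rewrite !mulmx0 subr0 !mulmxN mulmx1 subrr.
have yV : y *m S *m V^T = 0.
  move: VV UV; rewrite -!mulmxA /y !(mulmxDl, mulNmx) -!mulmxA => -> ->.
  by rewrite !mulmx0 addr0 mulmx1 subrr.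
have xy : x *m S *m y^T = 1%:M.
  rewrite /y linearD linearB /= !trmx_mul !mulmxDr mulmxN !mulmxA xU xV.
  by rewrite !mul0mx subr0 addr0.
have skew11 (z : 'rV[F]_n) : z *m S *m z^T = 0.
  by apply: skew_mx11; rewrite !trmx_mul trmxK St mulNmx mulmxN mulmxA.
suff UV' : @symplectic_family n (1 + m) S (col_mx x U) (col_mx y V).
  by exists (col_mx x U), (col_mx y V).
have trs p (z : 'M[F]_(p, n)) (w : 'rV[F]_n) : w *m S *m z^T = 0 -> z *m S *m w^T = 0.
  by move=> e; rewrite (skew_congr _ _ St) e trmx0 oppr0.
split; rewrite mul_col_mx tr_col_mx mul_col_row.
- by rewrite skew11 xU UU (trs _ U x xU) block_mx0.
- by rewrite skew11 yV VV (trs _ V y yV) block_mx0.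
- by rewrite xy xV UV (trs _ U y yU) -scalar_mx_block.
Qed.

(** The last extension starts from fewer than [n] vectors, hence the bound [n.+1]. For odd [n] it
    produces [n + 1] vectors, which contradicts [symplectic_family_le]; this is how parity is
    obtained. *)
Lemma symplectic_family_exists n (S : 'M[F]_n) m :
  S^T = - S -> S \in unitmx -> (m + m <= n.+1)%N ->
  exists U V : 'M[F]_(m, n), symplectic_family S U V.
Proof.
move=> St Su; elim: m => [_|m IHm].
  by exists 0, 0; split; apply/matrixP => -[].
rewrite addSn addnS ltnS => lt_mn.
have [|U [V UV]] := IHm; first by rewrite ltnW // ltnS ltnW.
exact: symplectic_extend St Su lt_mn UV.
Qed.

Lemma skew_unit_even n (S : 'M[F]_n) : S^T = - S -> S \in unitmx -> ~~ odd n.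
Proof.
move=> St Su; have [|U [V UV]] := @symplectic_family_exists n S (uphalf n) St Su.
  by rewrite addnn uphalf_half -[X in (_ <= X.+1)%N]odd_double_half doubleD;
     case: (odd n); rewrite ?ltnS // addnC leq_add2l.
have := symplectic_family_le St UV.
rewrite addnn uphalf_half -[X in (_ <= X)%N]odd_double_half doubleD leq_add2r.
by case: (odd n).
Qed.

Lemma skew_normal_form m (S : 'M[F]_(m + m)) : S^T = - S -> S \in unitmx ->
  exists2 T : 'M[F]_(m + m), T \in unitmx & T *m S *m T^T = symp_mx F m.
Proof.
move=> St Su; have [|U [V UV]] := @symplectic_family_exists _ S m St Su.
  exact: leqnSn.
have E := symplectic_family_gram St UV.
exists (col_mx U V) => //.
by have := symp_mx_unit m; rewrite -E !unitmx_mul => /andP[/andP[]].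
Qed.

End SymplecticBasis.

(** * Complex matrices as real block matrices *)

Section Realify.
Variable R : rcfType.
Local Notation C := R[i].

Lemma ReD (x y : C) : complex.Re (x + y) = complex.Re x + complex.Re y.
Proof. by case: x y => [a b] []. Qed.

Lemma ImD (x y : C) : complex.Im (x + y) = complex.Im x + complex.Im y.
Proof. by case: x y => [a b] []. Qed.

Definition re_mx p q (Z : 'M[C]_(p, q)) : 'M[R]_(p, q) := map_mx (@complex.Re R) Z.
Definition im_mx p q (Z : 'M[C]_(p, q)) : 'M[R]_(p, q) := map_mx (@complex.Im R) Z.

Lemma Re_sum (I : finType) (f : I -> C) :
  complex.Re (\sum_i f i) = \sum_i complex.Re (f i).
Proof. exact: (big_morph _ ReD erefl). Qed.

Lemma Im_sum (I : finType) (f : I -> C) :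
  complex.Im (\sum_i f i) = \sum_i complex.Im (f i).
Proof. exact: (big_morph _ ImD erefl). Qed.

Lemma re_mxM p q s (Y : 'M[C]_(p, q)) (Z : 'M[C]_(q, s)) :
  re_mx (Y *m Z) = re_mx Y *m re_mx Z - im_mx Y *m im_mx Z.
Proof.
apply/matrixP => i j; rewrite !mxE Re_sum -sumrB; apply: eq_bigr => l _.
by rewrite !mxE; case: (Y i l) (Z l j) => [a b] [].
Qed.

Lemma im_mxM p q s (Y : 'M[C]_(p, q)) (Z : 'M[C]_(q, s)) :
  im_mx (Y *m Z) = re_mx Y *m im_mx Z + im_mx Y *m re_mx Z.
Proof.
apply/matrixP => i j; rewrite !mxE Im_sum -big_split; apply: eq_bigr => l _.
by rewrite !mxE; case: (Y i l) (Z l j) => [a b] [].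
Qed.

(** The convention for the sign of the imaginary part makes the non-real [J_block] exactly the real
    form of the complex scalar [alpha + i beta]. *)
Definition realify p q (Z : 'M[C]_(p, q)) : 'M[R]_(p + p, q + q) :=
  block_mx (re_mx Z) (im_mx Z) (- im_mx Z) (re_mx Z).

Lemma realifyM p q s (Y : 'M[C]_(p, q)) (Z : 'M[C]_(q, s)) :
  realify (Y *m Z) = realify Y *m realify Z.
Proof.
rewrite /realify mulmx_block re_mxM im_mxM !(mulmxN, mulNmx) opprD.
by congr block_mx; rewrite // addrC.
Qed.

Lemma re_mx_scalar p (z : C) : re_mx (z%:M : 'M_p) = (complex.Re z)%:M.
Proof. by apply/matrixP => i j; rewrite !mxE; case: eqP. Qed.

Lemma im_mx_scalar p (z : C) : im_mx (z%:M : 'M_p) = (complex.Im z)%:M.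
Proof. by apply/matrixP => i j; rewrite !mxE; case: eqP. Qed.

Lemma realify_scalar p (z : C) : realify (z%:M : 'M_p) =
  block_mx (complex.Re z)%:M (complex.Im z)%:M (- complex.Im z)%:M (complex.Re z)%:M.
Proof. by rewrite /realify re_mx_scalar im_mx_scalar -raddfN. Qed.

Lemma realify1 p : realify (1%:M : 'M_p) = 1%:M.
Proof. by rewrite realify_scalar /= oppr0 !raddf0 -scalar_mx_block. Qed.

Lemma realify_inj p q : injective (@realify p q).
Proof.
move=> Y Z /eq_block_mx[/matrixP re_eq /matrixP im_eq _ _].
apply/matrixP => i j; have := re_eq i j; have := im_eq i j; rewrite !mxE.
by case: (Y i j) (Z i j) => [a b] [c d] /= -> ->.
Qed.

Lemma realify_unit p (Z : 'M[C]_p) : (realify Z \in unitmx) = (Z \in unitmx).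
Proof.
apply/idP/idP => [Zu|Zu]; last first.
  have : realify Z *m realify (invmx Z) = 1%:M.
    by rewrite -realifyM mulmxV // realify1.
  by case/mulmx1_unit.
rewrite -row_free_unit -kermx_eq0; apply/eqP/realify_inj.
rewrite -[LHS](mulmxK Zu) -realifyM mulmx_ker.
have realify0 : realify (0 : 'M_p) = 0.
  by rewrite -(raddf0 (@scalar_mx C p)) realify_scalar /= oppr0 !raddf0 block_mx0.
by rewrite realify0 mul0mx.
Qed.

Definition flip_mx p : 'M[R]_(p + p) := block_mx 1%:M 0 0 (- 1%:M).

(** The real transpose of [realify Z] is the real form of the conjugate transpose, and [flip_mx] is
    the real form of conjugation. Together they give the plain transpose, so a real congruence by
    [realify T] acts on the complex form as [T Z T^T], not as a Hermitian congruence. *)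
Lemma flip_realify_tr p q (Z : 'M[C]_(p, q)) :
  flip_mx q *m (realify Z)^T = realify Z^T *m flip_mx p.
Proof.
rewrite /flip_mx /realify tr_block_mx !mulmx_block.
rewrite !(mul0mx, mulmx0, mulmx1, mul1mx, add0r, addr0, mulmxN, mulNmx).
rewrite /re_mx /im_mx !map_trmx.
by congr block_mx; rewrite linearN /= ?opprK.
Qed.

Lemma commute_scalar_block p (a b : R) (S : 'M[R]_(p + p)) : b != 0 ->
  let J : 'M_(p + p) := block_mx a%:M b%:M (- b)%:M a%:M in
  S *m J^T = J *m S ->
  exists P Q, S = block_mx P Q Q (- P).
Proof.
move=> b0 J; rewrite -[S]submxK /J tr_block_mx !tr_scalar_mx !mulmx_block.
move: (ulsubmx S) (ursubmx S) (dlsubmx S) (drsubmx S) => P Q Q' P'.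
rewrite !mul_mx_scalar !mul_scalar_mx => /eq_block_mx[e1 e2 _ _].
exists P, Q; congr block_mx.
  by move/addrI: e1 => /(scalerI b0) ->.
rewrite addrC in e2; move/addrI: e2 => /esym; rewrite scaleNr -scalerN.
exact: (scalerI b0).
Qed.

(* [S] encodes the complex bilinear form [P - iQ]: the relation with [J] makes
   [S] the real form of a complex matrix composed with a conjugation. *)
Lemma commute_realify p (a b : R) (S : 'M[R]_(p + p)) : b != 0 -> S^T = - S ->
  let J : 'M_(p + p) := block_mx a%:M b%:M (- b)%:M a%:M in
  S *m J^T = J *m S ->
  exists2 Z : 'M[C]_p, Z^T = - Z & S = realify Z *m flip_mx p.
Proof.
move=> b0 St J SJ; have [P [Q E]] := commute_scalar_block b0 SJ.
move: St; rewrite E tr_block_mx opp_block_mx => /eq_block_mx[Pt Qt _ _].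
exists (\matrix_(i, j) Complex (P i j) (- Q i j)).
  apply/matrixP => i j; rewrite !mxE.
  move/matrixP/(_ i j): Pt; rewrite !mxE => ->.
  by move/matrixP/(_ i j): Qt; rewrite !mxE => ->.
rewrite /realify /flip_mx mulmx_block.
rewrite !(mul0mx, mulmx0, mulmx1, mul1mx, add0r, addr0, mulmxN).
by congr block_mx; apply/matrixP => i j; rewrite !mxE ?opprK.
Qed.

End Realify.

(** * Parity and normal form of a single block *)

Section Blocks.
Variable R : realType.

Lemma char2_complex : (2 : R[i]) != 0.
Proof. by rewrite pnatr_eq0. Qed.

(** In the non-real case the real size [d + d] carries no information; parity comes from the
    alternating complex form [Z], whose size is [d]. *)
Lemma block_even b d (al be : R) (S : 'M[R]_(bdim b d)) :
  (b -> be != 0) -> S^T = - S -> S \in unitmx ->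
  S *m (J_block b d al be)^T = J_block b d al be *m S -> ~~ odd d.
Proof.
case: b S => /= S b0 St Su SJ; last by apply: skew_unit_even St Su; rewrite pnatr_eq0.
have [Z Zt E] := commute_realify (b0 isT) St SJ.
apply: (skew_unit_even char2_complex Zt).
by move: Su; rewrite E unitmx_mul realify_unit => /andP[].
Qed.

Lemma block_normal_form b m (al be : R) (S : 'M[R]_(bdim b (m + m))) :
  (b -> be != 0) -> S^T = - S -> S \in unitmx ->
  S *m (J_block b (m + m) al be)^T = J_block b (m + m) al be *m S ->
  exists T, [/\ T \in unitmx,
    T *m J_block b (m + m) al be = J_block b (m + m) al be *m T
    & T *m S *m T^T = Gamma_block R b (fun _ : 'I_m => false)].
Proof.
case: b S => /= S b0 St Su SJ; last first.
  have [|T Tu TS] := skew_normal_form _ St Su; first by rewrite pnatr_eq0.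
  by exists T; split=> //; rewrite mul_mx_scalar mul_scalar_mx.
have [Z Zt E] := commute_realify (b0 isT) St SJ.
have Zu : Z \in unitmx by move: Su; rewrite E unitmx_mul realify_unit => /andP[].
have [T Tu TZ] := skew_normal_form char2_complex Zt Zu.
have EJ : block_mx al%:M be%:M (- be)%:M al%:M
    = realify ((Complex al be)%:M : 'M_(m + m)) by rewrite realify_scalar.
(* [J] is the real form of a scalar matrix, so every real form commutes with it. *)
exists (realify T); split.
- by rewrite realify_unit.
- by rewrite EJ -!realifyM mul_mx_scalar mul_scalar_mx.
rewrite E -!mulmxA flip_realify_tr !mulmxA -!realifyM TZ.
have -> : sign_mx R (fun _ : 'I_m => false) = 1%:M.
  by apply/matrixP => i j; rewrite !mxE.
rewrite /realify /flip_mx mulmx_block.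
rewrite !(mul0mx, mulmx0, mulmx1, mul1mx, add0r, addr0, mulmxN).
have -> : re_mx (symp_mx R[i] m) = symp_mx R m.
  rewrite /re_mx /symp_mx map_block_mx; congr block_mx;
  by apply/matrixP => i j; rewrite !mxE ?raddfN //; case: eqP.
have -> : im_mx (symp_mx R[i] m) = 0.
  rewrite /im_mx /symp_mx map_block_mx -[RHS]block_mx0; congr block_mx;
  by apply/matrixP => i j; rewrite !mxE //; case: eqP; rewrite /= ?oppr0.
by rewrite oppr0 /skew_block /symp_mx opp_block_mx oppr0 opprK.
Qed.

End Blocks.

(** * Block diagonalisation *)

Section BlockDiagonal.
Variable R : realType.

(* Imaginary part of an eigenvalue of [J_block b d al be]. *)
Definition bim (b : bool) (be : R) : R := if b then be else 0.

(** Both kinds of block are annihilated by [(t - al)^2 + (bim b be)^2], which lets real and non-real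
    blocks be treated together. *)
Lemma J_block_sq b d (al be : R) (J := J_block b d al be) :
  J *m J = (2 * al) *: J - (al ^+ 2 + bim b be ^+ 2)%:M.
Proof.
rewrite {}/J; case: b => /=; last first.
  by rewrite mul_scalar_mx !scale_scalar_mx -raddfB /=; congr _%:M; ring.
rewrite mulmx_block scale_block_mx !mul_scalar_mx !scale_scalar_mx.
rewrite -!raddfD scalar_mx_block opp_block_mx add_block_mx -!raddfB -!raddfN /=.
by congr block_mx; rewrite -?raddfD /= ?addr0 ?oppr0 ?addr0; congr _%:M; ring.
Qed.

(** Only the square of [c] is prescribed, so that both conjugate eigenvalues are covered;
    [disjoint_params] compares blocks whose [be] may differ in sign. In the non-real case the left
    eigenvector is [(be u, - i c u)]. *)
Lemma eigenvalue_J_block (b : bool) d (al be c : R) : (0 < d)%N -> (b -> be != 0) ->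
  c ^+ 2 = bim b be ^+ 2 -> spectrum (J_block b d al be) (Complex al c).
Proof.
case: d => // d _; case: b => /= [/(_ isT) be0 cb|_]; last first.
  rewrite expr0n /= => /eqP; rewrite sqrf_eq0 => /eqP ->.
  apply/eigenvalueP; exists (delta_mx 0 ord0); last first.
    by apply/rV0Pn; exists ord0; rewrite mxE eqxx oner_eq0.
  by rewrite map_scalar_mx mul_mx_scalar.
pose u : 'rV[R[i]]_d.+1 := delta_mx 0 ord0.
apply/eigenvalueP; exists (row_mx ((Complex be 0) *: u) ((Complex 0 (- c)) *: u)).
  rewrite map_block_mx !map_scalar_mx mul_row_block !mul_mx_scalar.
  rewrite !scalerA -!scalerDl scale_row_mx !scalerA.
  congr (row_mx (_ *: _) (_ *: _)); apply/eqP; rewrite eq_complex /=;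
  by apply/andP; split; apply/eqP; try ring; rewrite ?mulrN ?mulNr -?expr2; ring: cb.
apply/eqP => /(congr1 lsubmx); rewrite row_mxKl linear0.
move=> /matrixP/(_ 0 ord0)/eqP; rewrite !mxE eqxx mulr1 eq_complex /=.
by rewrite (negPf be0).
Qed.

(** Uniqueness for a Sylvester equation, without leaving the reals. Both quadratics, evaluated at
    [J1], annihilate [S], because [S J2^T = J1 S] transfers the second one. They are coprime, so [S]
    vanishes. *)
Lemma sylvester_eq0 p q (J1 : 'M[R]_p) (J2 : 'M[R]_q) (a1 a2 c1 c2 : R)
    (S : 'M[R]_(p, q)) :
  J1 *m J1 = (2 * a1) *: J1 - (a1 ^+ 2 + c1 ^+ 2)%:M ->
  J2 *m J2 = (2 * a2) *: J2 - (a2 ^+ 2 + c2 ^+ 2)%:M ->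
  ~ (a1 = a2 /\ c1 ^+ 2 = c2 ^+ 2) ->
  S *m J2^T = J1 *m S -> S = 0.
Proof.
move=> J1sq J2sq ne SJ.
pose Y := J1 *m S; pose W := J1 *m Y; pose Z := J1 *m W.
have W1 : W = (2 * a1) *: Y - (a1 ^+ 2 + c1 ^+ 2) *: S.
  by rewrite /W mulmxA J1sq mulmxBl mul_scalar_mx -scalemxAl.
have W2 : W = (2 * a2) *: Y - (a2 ^+ 2 + c2 ^+ 2) *: S.
  rewrite /W /Y -SJ mulmxA -SJ -mulmxA -trmx_mul J2sq linearB linearZ /=.
  by rewrite tr_scalar_mx mulmxBr mul_mx_scalar -scalemxAr.
have JW1 : Z = (2 * a1) *: W - (a1 ^+ 2 + c1 ^+ 2) *: Y.
  by rewrite /Z {1}W1 mulmxBr -!scalemxAr.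
have JW2 : Z = (2 * a2) *: W - (a2 ^+ 2 + c2 ^+ 2) *: Y.
  by rewrite /Z {1}W2 mulmxBr -!scalemxAr.
(* The difference of the two quadratics is [c t + e]. The quantity in [De0] is the squared modulus
   of its value at [a1 + i c1], that is, the resultant of the quadratics. *)
pose c := 2 * (a2 - a1); pose e := a1 ^+ 2 + c1 ^+ 2 - (a2 ^+ 2 + c2 ^+ 2).
have De0 : (c * a1 + e) ^+ 2 + (c * c1) ^+ 2 != 0.
  rewrite paddr_eq0 ?sqr_ge0 // !sqrf_eq0; apply/negP => /andP[/eqP h1].
  rewrite mulf_eq0 => /orP[/eqP h2|/eqP h2].
    move: h2 => /eqP; rewrite /c mulf_eq0 pnatr_eq0 subr_eq0 /= => /eqP h2.
    apply: ne; split=> //; apply/eqP; rewrite -subr_eq0 -h1 /c /e h2.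
    by apply/eqP; ring.
  have : (a1 - a2) ^+ 2 + c2 ^+ 2 = 0.
    by rewrite -[RHS]oppr0 -[in RHS]h1 /c /e h2; ring.
  move=> /eqP; rewrite paddr_eq0 ?sqr_ge0 // !sqrf_eq0 subr_eq0.
  by move=> /andP[/eqP a12 /eqP c20]; apply: ne; rewrite a12 h2 c20.
apply/matrixP => i j; rewrite [RHS]mxE.
apply: (mulfI De0); rewrite mulr0.
move: W1 W2 JW1 JW2; clearbody Z; clearbody W; clearbody Y.
move=> /matrixP/(_ i j) + /matrixP/(_ i j) + /matrixP/(_ i j) + /matrixP/(_ i j).
rewrite !mxE; move: (S i j) (Y i j) (W i j) (Z i j) => x y w z h1 h2 h3 h4.
have e1 : c * y + e * x = 0.
  transitivity (w - w); last exact: subrr.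
  by rewrite {1}h2 h1 /c /e; ring.
have e2 : c * w + e * y = 0.
  transitivity (z - z); last exact: subrr.
  by rewrite {1}h4 h3 /c /e; ring.
(* A Bezout combination: once [w] is replaced using [h1], the terms in [y] cancel and the resultant
   times [x] remains. *)
transitivity ((e + 2 * a1 * c) * (c * y + e * x) - c * (c * w + e * y)).
  by rewrite h1 /e; ring.
by rewrite e1 e2 !mulr0 subrr.
Qed.

Section Assembly.
Variables (s : nat) (b : 'I_s -> bool) (d : 'I_s -> nat) (al be : 'I_s -> R).
Hypothesis d_gt0 : forall j, (0 < d j)%N.
Hypothesis be_neq0 : forall j, b j -> be j != 0.
Hypothesis disj : forall i j, i != j -> forall z : R[i],
  ~~ (spectrum (J_block (b i) (d i) (al i) (be i)) z
      && spectrum (J_block (b j) (d j) (al j) (be j)) z).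

Lemma disjoint_params i j : i != j ->
  ~ (al i = al j /\ bim (b i) (be i) ^+ 2 = bim (b j) (be j) ^+ 2).
Proof.
move=> ne [al_eq im_eq]; have := disj ne (Complex (al i) (bim (b i) (be i))).
rewrite eigenvalue_J_block //; last exact: be_neq0.
by rewrite al_eq eigenvalue_J_block //; exact: be_neq0.
Qed.

Local Notation Jd := (\mxdiag_j J_block (b j) (d j) (al j) (be j)).

Lemma mxdiagM (A B : forall j, 'M[R]_(bdim (b j) (d j))) :
  \mxdiag_j A j *m \mxdiag_j B j = \mxdiag_j (A j *m B j).
Proof.
rewrite mul_mxdiag_mxblock; apply/eq_mxblock => i j.
by case: eqVneq => [->|_]; rewrite ?conform_mx_id ?mulmx0.
Qed.

Lemma mxdiag_unit (A : forall j, 'M[R]_(bdim (b j) (d j))) :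
  (forall j, A j \in unitmx) -> \mxdiag_j A j \in unitmx.
Proof.
move=> Au; have : \mxdiag_j A j *m \mxdiag_j invmx (A j) = 1%:M.
  by rewrite mxdiagM -mxdiagZ; apply/eq_mxdiag => j; rewrite mulmxV.
by case/mulmx1_unit.
Qed.

Lemma commute_mxdiag (S : 'M[R]_(\sum_j bdim (b j) (d j))) :
  S^T = - S -> S \in unitmx -> S *m Jd^T = Jd *m S ->
  exists S_ : forall j, 'M[R]_(bdim (b j) (d j)),
    S = \mxdiag_j S_ j /\ forall j, [/\ (S_ j)^T = - S_ j, S_ j \in unitmx &
      S_ j *m (J_block (b j) (d j) (al j) (be j))^T
        = J_block (b j) (d j) (al j) (be j) *m S_ j].
Proof.
move=> St Su SJ.
have SJij i j : submxblock S i j *m (J_block (b j) (d j) (al j) (be j))^T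
    = J_block (b i) (d i) (al i) (be i) *m submxblock S i j.
  move: SJ; rewrite -{1 2}(submxblockK S) tr_mxdiag mul_mxblock_mxdiag.
  by rewrite mul_mxdiag_mxblock => /eq_mxblockP.
have S0 i j : i != j -> submxblock S i j = 0.
  move=> ne; apply: (sylvester_eq0 (J_block_sq _ _ _ _) (J_block_sq _ _ _ _)
    (disjoint_params ne) (SJij i j)).
have SE : S = \mxdiag_j submxblock S j j.
  apply/mxblockP => i j; rewrite [RHS]mxblockK.
  by case: eqVneq => [->|/S0->]; rewrite ?conform_mx_id.
exists (fun j => submxblock S j j); split=> // j; split=> //.
  by rewrite tr_submxblock St submxblockN.
(* As [S] is block diagonal, block [(j, j)] of [S S^-1 = 1] shows that the [j]-th diagonal blocks of
   [S] and [S^-1] are mutually inverse. *)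
have := mulmxV Su; rewrite {1}SE -(submxblockK (invmx S)) mul_mxdiag_mxblock.
move=> /(congr1 (fun M => submxblock M j j)); rewrite mxblockK.
by rewrite -(@mxdiagZ _ _ (fun j => bdim (b j) (d j))) submxblock_diag => /mulmx1_unit[].
Qed.

(** The size [N] is a variable so that the cast along [e] can be eliminated; it becomes [k * n] in
    the theorem. *)
Lemma blocks_even N (e : (\sum_j bdim (b j) (d j) = N)%N) (S : 'M[R]_N) :
  S^T = - S -> S \in unitmx ->
  S *m (castmx (e, e) Jd)^T = castmx (e, e) Jd *m S -> forall j, ~~ odd (d j).
Proof.
case: N / e in S *; rewrite castmx_id => St Su SJ j.
have [S_ [_ /(_ j)[Sjt Sju SjJ]]] := commute_mxdiag St Su SJ.
exact: block_even (@be_neq0 j) Sjt Sju SjJ.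
Qed.

End Assembly.

Lemma blocks_normal_form s (b : 'I_s -> bool) (m : 'I_s -> nat) (al be : 'I_s -> R)
    N (e : (\sum_j bdim (b j) (m j + m j) = N)%N)
    (J := castmx (e, e) (\mxdiag_j J_block (b j) (m j + m j) (al j) (be j)))
    (S : 'M[R]_N) :
  (forall j, 0 < m j + m j)%N -> (forall j, b j -> be j != 0) ->
  (forall i j, i != j -> forall z : R[i],
     ~~ (spectrum (J_block (b i) (m i + m i) (al i) (be i)) z
         && spectrum (J_block (b j) (m j + m j) (al j) (be j)) z)) ->
  S^T = - S -> S \in unitmx -> S *m J^T = J *m S ->
  exists T, [/\ T \in unitmx, T *m J = J *m T
    & T *m S *m T^T = castmx (e, e)
        (\mxdiag_j Gamma_block R (b j) (fun _ : 'I_(m j) => false))].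
Proof.
rewrite {}/J => m0 be0 disj; case: N / e in S *; rewrite !castmx_id => St Su SJ.
have [S_ [-> S_P]] := commute_mxdiag m0 be0 disj St Su SJ.
have /fin_all_exists[T TP] j : exists T_j, [/\ T_j \in unitmx,
    T_j *m J_block (b j) (m j + m j) (al j) (be j)
      = J_block (b j) (m j + m j) (al j) (be j) *m T_j
    & T_j *m S_ j *m T_j^T = Gamma_block R (b j) (fun _ => false)].
  by case: (S_P j) => ? ? ?; apply: block_normal_form; first exact: be0.
exists (\mxdiag_j T j); split.
- by apply: mxdiag_unit => j; case: (TP j).
- by rewrite !mxdiagM; apply/eq_mxdiag => j; case: (TP j).
- by rewrite tr_mxdiag !mxdiagM; apply/eq_mxdiag => j; case: (TP j).
Qed.

End BlockDiagonal.

(** * The Gram matrix of a standard pair *)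

Lemma castmx_gram (F : fieldType) N N' m (e : N = N') (C : 'M[F]_(N, m)) (H : 'M[F]_N) :
  (castmx (e, erefl) C)^T *m castmx (e, e) H *m castmx (e, erefl) C = C^T *m H *m C.
Proof. by case: N' / e; rewrite !castmx_id. Qed.

Lemma castmx_unit (F : fieldType) N N' (e : N = N') (H : 'M[F]_N) :
  (castmx (e, e) H \in unitmx) = (H \in unitmx).
Proof. by case: N' / e; rewrite castmx_id. Qed.

Lemma castmx_mulr (F : fieldType) N N' m p (e : N = N') (C : 'M[F]_(N, m)) (V : 'M_(m, p)) :
  castmx (e, erefl) C *m V = castmx (e, erefl) (C *m V).
Proof. by case: N' / e; rewrite !castmx_id. Qed.

Lemma invmx_unique (F : fieldType) N (B C : 'M[F]_N) : B *m C = 1%:M -> invmx B = C.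
Proof. by move=> BC; have [Bu _] := mulmx1_unit BC; rewrite -[C](mulKmx Bu) BC mulmx1. Qed.

Lemma invmx_congr (F : fieldType) N (M T : 'M[F]_N) : M \in unitmx -> T \in unitmx ->
  invmx ((invmx T)^T *m M *m invmx T) = T *m invmx M *m T^T.
Proof.
move=> Mu Tu; apply: invmx_unique.
by rewrite -!mulmxA mulKmx // mulKVmx // -trmx_mul mulmxV // trmx1.
Qed.

Lemma skew_invmx (F : fieldType) N (S : 'M[F]_N) :
  S \in unitmx -> S^T = - S -> (invmx S)^T = - invmx S.
Proof.
move=> Su St; rewrite trmx_inv St; apply: invmx_unique.
by rewrite mulmxN mulNmx opprK mulmxV.
Qed.

Lemma commute_invmx (F : fieldType) N (T J : 'M[F]_N) :
  T \in unitmx -> T *m J = J *m T -> invmx T *m J = J *m invmx T.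
Proof.
by move=> Tu TJ; rewrite -[RHS](mulKmx Tu) (mulmxA T) TJ mulmxK.
Qed.

Lemma commute_expr (F : fieldType) N (V J : 'M[F]_N) i :
  V *m J = J *m V -> V *m J ^+ i = J ^+ i *m V.
Proof.
move=> VJ; elim: i => [|i IHi]; first by rewrite expr0 mulmx1 mul1mx.
by rewrite exprSr mulmxA IHi -!mulmxA VJ.
Qed.

Section Hankel.
Variables (R : realType) (n k : nat) (A : 'I_k.+1 -> 'M[R]_n).

(** Extending the coefficients by zero to all naturals removes the truncation conditions from the
    Hankel sums. *)
Definition coef0 (i : nat) : 'M[R]_n := if (i <= k)%N then A (inord i) else 0.

Lemma coef0_ord (i : 'I_k.+1) : coef0 i = A i.
Proof. by rewrite /coef0 -ltnS ltn_ord inord_val. Qed.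

(** The matrix is block anti-triangular with [A_k] on the anti-diagonal. For a left null vector [v],
    block column [k - 1 - p] kills block [p] of [v] once the earlier blocks vanish. *)
Lemma hankel_coef_unit : A ord_max \in unitmx -> hankel_coef A \in unitmx.
Proof.
move=> Au; rewrite castmx_unit -row_free_unit; apply: inj_row_free => v.
rewrite -[v]submxrowK mul_mxrow_mxblock -[RHS](@mxrow0 _ k (fun=> n)).
move=> /eq_mxrowP v_eq; rewrite -[RHS](@mxrow0 _ k (fun=> n)); apply/eq_mxrow => p.
have [l] := ubnP (val p); elim: l => // l IHl in p *; rewrite ltnS => le_pl.
have kS : k.-1.+1 = k := ltn_predK (ltn_ord p).
have lt_pk : (k.-1 - p < k)%N by rewrite -[X in (_ < X)%N]kS ltnS leq_subr.
have p_q : (p + (k.-1 - p) = k.-1)%N by rewrite subnKC // -ltnS kS.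
have := v_eq (Ordinal lt_pk); rewrite (bigD1 p) //= big1 => [|p' ne].
  rewrite p_q kS leqnn addr0 => vA.
  have kE : inord k = ord_max :> 'I_k.+1 by apply: ord_inj; rewrite inordK.
  by rewrite kE in vA; rewrite -(mulmxK Au (submxrow v p)) vA mul0mx.
have [lt_p'p|lt_pp'|/val_inj eq_p] := ltngtP p' p.
- by rewrite IHl ?mul0mx // (leq_trans lt_p'p).
- rewrite ifN ?mulmx0 // -leqNgt.
  apply: (@leq_trans (p + (k.-1 - p)).+1); first by rewrite p_q kS.
  by rewrite ltn_add2r.
- by rewrite eq_p eqxx in ne.
Qed.

Section Pair.
Variables (X : 'M[R]_(n, k * n)) (J : 'M[R]_(k * n)).
Hypothesis skew : T_skew_symmetric A.

Let XJ i := X *m J ^+ i.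
Let M := (stack_XJ X J)^T *m hankel_coef A *m stack_XJ X J.

Lemma stack_gramE :
  M = \sum_(p < k) \sum_(q < k) (XJ p)^T *m coef0 (p + q).+1 *m XJ q.
Proof.
rewrite /M castmx_gram tr_mxcol mul_mxrow_mxblock mul_mxrow_mxcol exchange_big /=.
by apply: eq_bigr => q _; rewrite mulmx_suml; apply: eq_bigr.
Qed.

Lemma coef0_skew i : (coef0 i)^T = - coef0 i.
Proof. by rewrite /coef0; case: ifP => _; rewrite ?skew // trmx0 oppr0. Qed.

Lemma stack_gram_skew : M^T = - M.
Proof.
rewrite stack_gramE [in RHS]exchange_big /= linear_sum -sumrN.
apply: eq_bigr => p _; rewrite linear_sum -sumrN; apply: eq_bigr => q _ /=.
by rewrite trmx_mul [(_ *m coef0 _)^T]trmx_mul trmxK coef0_skew mulNmx mulmxN mulmxA addnC.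
Qed.

Hypothesis PXJ : \sum_(i < k.+1) A i *m X *m J ^+ i = 0.

(* Both products are the sum of the terms [F p q] over the triangle
   [p + q <= k], up to the edges [q = 0] and [p = 0], which sum to zero. *)
Lemma stack_gramJ : M *m J = J^T *m M.
Proof.
pose F p q := (XJ p)^T *m coef0 (p + q) *m XJ q.
have XJS i : XJ i *m J = XJ i.+1 by rewrite /XJ exprSr mulmxA.
have MJ : M *m J = \sum_(p < k) \sum_(q < k) F p q.+1.
  rewrite stack_gramE mulmx_suml; apply: eq_bigr => p _.
  by rewrite mulmx_suml; apply: eq_bigr => q _; rewrite -mulmxA XJS /F addnS.
have JM : J^T *m M = \sum_(q < k) \sum_(p < k) F p.+1 q.
  rewrite stack_gramE exchange_big /= mulmx_sumr; apply: eq_bigr => q _.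
  rewrite mulmx_sumr; apply: eq_bigr => p _.
  by rewrite mulmxA (mulmxA J^T) -trmx_mul XJS.
have F0 p q : (k < p + q)%N -> F p q = 0.
  by move=> lt; rewrite /F /coef0 leqNgt lt mulmx0 mul0mx.
have row0 : \sum_(q < k.+1) F 0%N q = 0.
  transitivity (X^T *m \sum_(i < k.+1) A i *m X *m J ^+ i); last first.
    by rewrite PXJ mulmx0.
  rewrite mulmx_sumr; apply: eq_bigr => q _.
  by rewrite /F add0n coef0_ord /XJ expr0 mulmx1 !mulmxA.
have col0 : \sum_(p < k.+1) F p 0%N = 0.
  transitivity (- ((\sum_(i < k.+1) A i *m X *m J ^+ i)^T *m X)); last first.
    by rewrite PXJ trmx0 mul0mx oppr0.
  rewrite linear_sum mulmx_suml -sumrN; apply: eq_bigr => p _.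
  rewrite /F addn0 coef0_ord /XJ expr0 mulmx1 /= -(mulmxA (A p)) [(A p *m _)^T]trmx_mul skew.
  by rewrite mulmxN mulNmx opprK.
have tot1 : M *m J = \sum_(p < k.+1) \sum_(q < k.+1) F p q.
  (* In row [k] only the corner [F k 0] survives; it completes the missing column [q = 0] to the sum
     [col0], which is zero. *)
  have edge : \sum_(q < k.+1) F k q = F k 0%N.
    by rewrite big_ord_recl big1 ?addr0 // => q _; rewrite F0 //= addnS ltnS leq_addr.
  rewrite MJ [RHS]big_ord_recr /= edge.
  rewrite -[LHS]addr0 -[X in _ + X = _]col0 big_ord_recr /= addrA; congr (_ + _).
  by rewrite -big_split; apply: eq_bigr => p _; rewrite big_ord_recl addrC.
have tot2 : J^T *m M = \sum_(q < k.+1) \sum_(p < k.+1) F p q.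
  have edge : \sum_(p < k.+1) F p k = F 0%N k.
    by rewrite big_ord_recl big1 ?addr0 // => p _; rewrite F0 //= addSn ltnS leq_addl.
  rewrite JM [RHS]big_ord_recr /= edge.
  rewrite -[LHS]addr0 -[X in _ + X = _]row0 big_ord_recr /= addrA; congr (_ + _).
  by rewrite -big_split; apply: eq_bigr => q _; rewrite big_ord_recl addrC.
by rewrite tot1 tot2 exchange_big.
Qed.

End Pair.

Lemma pair_Gamma_unit (X : 'M[R]_(n, k * n)) J : A ord_max \in unitmx ->
  stack_XJ X J \in unitmx -> pair_Gamma A X J \in unitmx.
Proof.
by move=> Au Xu; rewrite unitmx_inv !unitmx_mul unitmx_tr Xu hankel_coef_unit.
Qed.

Lemma pair_Gamma_S (X : 'M[R]_(n, k * n)) J : T_skew_symmetric A ->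
  A ord_max \in unitmx -> standard_pair A X J -> S_JTmm J (pair_Gamma A X J).
Proof.
move=> skew Au [Xu PXJ]; split.
  by apply: skew_invmx; rewrite ?stack_gram_skew // -unitmx_inv pair_Gamma_unit.
have := pair_Gamma_unit Au Xu; rewrite unitmx_inv => Mu.
rewrite /pair_Gamma -[LHS](mulmxK Mu) -(mulmxA _ J^T) -stack_gramJ //.
by rewrite mulKmx.
Qed.

Lemma stack_XJ_mulr (X : 'M[R]_(n, k * n)) J V : V *m J = J *m V ->
  stack_XJ (X *m V) J = stack_XJ X J *m V.
Proof.
move=> VJ; rewrite /stack_XJ castmx_mulr mxcol_mul; congr castmx; apply: eq_mxcol => i.
by rewrite -!mulmxA commute_expr.
Qed.

Lemma pair_Gamma_congr (X : 'M[R]_(n, k * n)) J T : A ord_max \in unitmx ->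
  stack_XJ X J \in unitmx -> T \in unitmx -> T *m J = J *m T ->
  pair_Gamma A (X *m invmx T) J = T *m pair_Gamma A X J *m T^T.
Proof.
move=> Au Xu Tu TJ; have := pair_Gamma_unit Au Xu; rewrite unitmx_inv => Mu.
rewrite /pair_Gamma stack_XJ_mulr; last exact: commute_invmx.
by rewrite -invmx_congr //; congr invmx; rewrite trmx_mul !mulmxA.
Qed.

Lemma standard_pair_mulr (X : 'M[R]_(n, k * n)) J V : V \in unitmx ->
  V *m J = J *m V -> standard_pair A X J -> standard_pair A (X *m V) J.
Proof.
move=> Vu VJ [Xu PXJ]; split; first by rewrite stack_XJ_mulr // unitmx_mul Xu.
rewrite -[RHS](mul0mx _ V) -[X in _ = X *m _]PXJ mulmx_suml; apply: eq_bigr => i _.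
by rewrite -!mulmxA commute_expr.
Qed.

End Hankel.

(** * Multiplicities *)

Section StandardPairKernel.
Variable F : fieldType.

Lemma stack_inj (n k N : nat) (e : (\sum_(i < k) n = N)%N) (C : 'I_k -> 'M[F]_(n, N))
    m (Y : 'M[F]_(m, N)) :
  castmx (e, erefl) (\mxcol_i C i) \in unitmx -> (forall i, Y *m (C i)^T = 0) -> Y = 0.
Proof.
case: N / e in C Y *; rewrite castmx_id => Cu YC.
have CTu : (\mxcol_i C i)^T \in unitmx by rewrite unitmx_tr.
rewrite -(mulmxK CTu Y) tr_mxcol mul_mxrow.
under eq_mxrow do rewrite YC.
by rewrite mxrow0 mul0mx.
Qed.

Lemma stack_surj (n k N : nat) (e : (\sum_(i < k) n = N)%N) (C : 'I_k -> 'M[F]_(n, N))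
    m (V : 'I_k -> 'M[F]_(m, n)) :
  castmx (e, erefl) (\mxcol_i C i) \in unitmx ->
  exists Y : 'M[F]_(m, N), forall i, Y *m (C i)^T = V i.
Proof.
case: N / e in C *; rewrite castmx_id => Cu.
have CTu : (\mxcol_i C i)^T \in unitmx by rewrite unitmx_tr.
exists (\mxrow_i V i *m invmx (\mxcol_i C i)^T) => i.
have := mulmxKV CTu (\mxrow_i V i); rewrite {2}tr_mxcol mul_mxrow.
by move=> /eq_mxrowP.
Qed.

(* [Y |-> Y X^T] maps [ker (J - z)^T] isomorphically onto [ker P(z)^T]. *)
Lemma standard_pair_kernel n k N (e : (\sum_(i < k) n = N)%N) (A : 'I_k.+1 -> 'M[F]_n)
    (X : 'M[F]_(n, N)) (J : 'M[F]_N) (z : F) : (0 < k)%N ->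
  A ord_max \in unitmx ->
  castmx (e, erefl) (\mxcol_(i < k) (X *m J ^+ i)) \in unitmx ->
  \sum_(i < k.+1) A i *m X *m J ^+ i = 0 ->
  \rank (kermx (\sum_(i < k.+1) z ^+ i *: A i)^T) = \rank (kermx (J - z%:M)^T).
Proof.
move=> k_gt0 Au Xu PXJ; set P := \sum_(i < k.+1) _.
have PXJ_T m (Y : 'M[F]_(m, N)) : \sum_(i < k.+1) Y *m (X *m J ^+ i)^T *m (A i)^T = 0.
  transitivity (Y *m (\sum_(i < k.+1) A i *m X *m J ^+ i)^T); last first.
    by rewrite PXJ trmx0 mulmx0.
  rewrite linear_sum mulmx_sumr; apply: eq_bigr => i _ /=.
  by rewrite -(mulmxA (A i)) [(A i *m _)^T]trmx_mul mulmxA.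
have PT m (W : 'M[F]_(m, n)) : W *m P^T = \sum_(i < k.+1) z ^+ i *: W *m (A i)^T.
  rewrite /P linear_sum mulmx_sumr; apply: eq_bigr => i _ /=.
  by rewrite linearZ /= -scalemxAr -scalemxAl.
have YJ m (Y : 'M[F]_(m, N)) i : Y *m J^T = z *: Y ->
    Y *m (X *m J ^+ i)^T = z ^+ i *: (Y *m X^T).
  move=> YJ; elim: i => [|i IHi]; first by rewrite !expr0 mulmx1 scale1r.
  rewrite exprSr exprS mulmxA trmx_mul mulmxA YJ -scalemxAl IHi.
  by rewrite scalerA.
set K := kermx (J - z%:M)^T; set L := kermx P^T.
have KJ : K *m J^T = z *: K.
  have := mulmx_ker (J - z%:M)^T; rewrite -/K linearB /= tr_scalar_mx mulmxBr mul_mx_scalar.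
  by move=> /eqP; rewrite subr_eq0 => /eqP.
(* Injectivity of [Y |-> Y X^T] on [K]: there [Y (X J^i)^T = z^i Y X^T], so [Y X^T = 0] makes [Y]
   vanish against the whole stacked matrix. *)
have cap0 : (K :&: kermx X^T)%MS = 0.
  set Y := (_ :&: _)%MS; apply: (stack_inj Xu) => i.
  have /submxP[B YB] : (Y <= K)%MS by exact: capmxSl.
  have /sub_kermxP YX : (Y <= kermx X^T)%MS by exact: capmxSr.
  by rewrite YJ ?YX ?scaler0 // YB -mulmxA KJ -scalemxAr.
have rankK : \rank (K *m X^T) = \rank K.
  by rewrite -(mxrank_mul_ker K X^T) cap0 mxrank0 addn0.
apply/eqP; rewrite -rankK eqn_leq; apply/andP; split; apply: mxrankS; last first.
  apply/sub_kermxP; rewrite PT -[RHS](PXJ_T _ K); apply: eq_bigr => i _.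
  by rewrite YJ.
(* Surjectivity: [Y] is prescribed by its values [z^i L] for [i < k]. The case [i = k] follows by
   comparing the equation of the pair with [L P(z)^T = 0] and cancelling [A_k]; then [Y (J - z)^T]
   vanishes against every stacked block. *)
have [Y YV] := stack_surj (fun i => z ^+ i *: L) Xu.
have YXL : Y *m X^T = L.
  by have := YV (Ordinal k_gt0); rewrite /= !expr0 mulmx1 scale1r.
have YXk i : (i <= k)%N -> Y *m (X *m J ^+ i)^T = z ^+ i *: L.
  rewrite leq_eqVlt => /orP[/eqP ->|lt_ik]; last by rewrite (YV (Ordinal lt_ik)).
  have AuT : (A ord_max)^T \in unitmx by rewrite unitmx_tr.
  apply: (can_inj (mulmxK AuT)).
  have := PXJ_T _ Y; have := PT _ L; rewrite mulmx_ker !big_ord_recr /=.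
  have -> : \sum_(i < k) Y *m (X *m J ^+ i)^T *m (A (widen_ord (leqnSn k) i))^T
     = \sum_(i < k) z ^+ i *: L *m (A (widen_ord (leqnSn k) i))^T.
    by apply: eq_bigr => j _; rewrite YV.
  by move=> e1 e2; move: (etrans e2 e1) => /addrI.
rewrite -YXL submxMr //; apply/sub_kermxP.
rewrite linearB /= tr_scalar_mx; apply: (stack_inj Xu) => i.
rewrite mulmxBr mul_mx_scalar mulmxBl -scalemxAl -mulmxA -trmx_mul.
rewrite (_ : X *m J ^+ i *m J = X *m J ^+ i.+1); last by rewrite exprSr mulmxA.
by rewrite !YXk // 1?ltnW // exprS scalerA subrr.
Qed.

End StandardPairKernel.

Section Multiplicity.
Variable R : realType.
Local Notation C := R[i].
Local Notation cmx := (map_mx (real_complex R)).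

Lemma mxrank_J_block (b : bool) d (al be : R) : (b -> be != 0) ->
  \rank (cmx (J_block b d al be) - (Complex al (bim b be))%:M) = (bdim b d - d)%N.
Proof.
case: b => /= [/(_ isT) be0|_]; last first.
  by rewrite map_scalar_mx /= subrr mxrank0 subnn.
have bC0 : Complex be 0 != 0 by rewrite eq_complex /= (negPf be0).
pose bC := Complex be 0; pose ii : C := Complex 0 1.
(* A rank factorisation through dimension [d]: the column has a left inverse and the row a right
   inverse. *)
have -> : cmx (block_mx al%:M be%:M (- be)%:M al%:M) - (Complex al be)%:M
   = col_mx 1%:M (- ii)%:M *m row_mx (- ii * bC)%:M (bC%:M : 'M[C]_d).
  rewrite mul_col_row !mul_scalar_mx !scale_scalar_mx scalar_mx_block.
  rewrite map_block_mx !map_scalar_mx /= opp_block_mx add_block_mx -!raddfB /= oppr0 !addr0.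
  congr block_mx; congr (_%:M); apply/eqP; rewrite eq_complex /=;
  by apply/andP; split; apply/eqP; ring.
rewrite addnK mxrankMfree; last first.
  apply/row_freeP; exists (col_mx 0 (bC^-1)%:M).
  by rewrite mul_row_col mulmx0 add0r mul_scalar_mx scale_scalar_mx mulfV.
apply/eqP/row_fullP; exists (row_mx 1%:M 0).
by rewrite mul_row_col mul1mx mul0mx addr0.
Qed.

Lemma rank_not_spectrum d (M : 'M[R]_d) z : ~~ spectrum M z ->
  \rank (cmx M - z%:M) = d.
Proof.
rewrite /spectrum /eigenvalue negbK => /eqP ker0; apply/eqP.
by rewrite -/(row_free _) -kermx_eq0; apply/eqP.
Qed.

(** By disjointness [z] is an eigenvalue of block [i] only, so all other diagonal blocks of the
    shifted matrix have full rank and block [i] alone contributes to the kernel. *)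
Lemma kermx_mxdiag_J_block s (b : 'I_s -> bool) (d : 'I_s -> nat) (al be : 'I_s -> R)
    N (e : (\sum_j bdim (b j) (d j) = N)%N) (i : 'I_s)
    (z := Complex (al i) (bim (b i) (be i))) :
  (forall j, 0 < d j)%N -> (forall j, b j -> be j != 0) ->
  (forall j j', j != j' -> forall z : R[i],
     ~~ (spectrum (J_block (b j) (d j) (al j) (be j)) z
         && spectrum (J_block (b j') (d j') (al j') (be j')) z)) ->
  \rank (kermx (cmx (castmx (e, e) (\mxdiag_j J_block (b j) (d j) (al j) (be j)))
               - z%:M)^T) = d i.
Proof.
move=> d0 be0 disj; case: N / e; rewrite castmx_id mxrank_ker mxrank_tr.
have -> : cmx (\mxdiag_j J_block (b j) (d j) (al j) (be j))
  = \mxdiag_j cmx (J_block (b j) (d j) (al j) (be j)).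
  apply/mxblockP => j j'; rewrite [RHS]mxblockK /submxblock -map_mxsub.
  rewrite -/(submxblock _ _ _) mxblockK.
  by case: eqVneq => [->|_]; rewrite ?conform_mx_id ?map_mx0.
rewrite -mxdiagZ -mxdiagB rank_mxdiag.
rewrite [X in (X - _)%N](bigD1 i) //= [X in (_ - X)%N](bigD1 i) //=.
rewrite mxrank_J_block; last exact: be0.
rewrite [X in (_ - (_ + X))%N](eq_bigr (fun j => bdim (b j) (d j))) => [|j ne]; last first.
  apply: rank_not_spectrum; have := disj _ _ ne z; rewrite negb_and => /orP[] //.
  by rewrite eigenvalue_J_block //; exact: be0.
rewrite subnDr subKn //; case: (b i) => //=; exact: leq_addr.
Qed.

Lemma geo_mult_standard_pair n k (A : 'I_k.+1 -> 'M[R]_n) X J z : (0 < k)%N ->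
  A ord_max \in unitmx -> standard_pair A X J ->
  geo_mult A z = \rank (kermx (cmx J - z%:M)^T).
Proof.
move=> k_gt0 Au [Xu PXJ].
have cmxX i : cmx (X *m J ^+ i) = cmx X *m cmx J ^+ i.
  rewrite map_mxM; congr (_ *m _).
  by elim: i => [|i IHi]; rewrite ?expr0 ?map_mx1 // !exprS map_mxM IHi.
apply: (@standard_pair_kernel _ _ _ _ (sum_nat_block n k) (fun i => cmx (A i)) (cmx X)) => //.
- by rewrite map_unitmx.
- rewrite -(map_unitmx (real_complex R)) map_castmx in Xu.
  congr (castmx _ _ \in unitmx): Xu.
  apply/mxcolP => i; rewrite [RHS]mxcolK /submxcol -map_mxsub -/(submxcol _ _).
  by rewrite mxcolK cmxX.
- rewrite -[RHS](map_mx0 (real_complex R)) -PXJ raddf_sum; apply: eq_bigr => i _ /=.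
  by rewrite -!mulmxA -cmxX -map_mxM.
Qed.

Lemma eigenvalue_geo_mult n k (A : 'I_k.+1 -> 'M[R]_n) z :
  (0 < geo_mult A z)%N -> mpoly_eigenvalue A z.
Proof.
move=> geo; rewrite /mpoly_eigenvalue rootE -horner_evalE -det_map_mx.
have -> : map_mx (horner_eval z) (mpoly_cmx A) = mpoly_eval A z.
  rewrite /mpoly_cmx /mpoly_eval raddf_sum; apply: eq_bigr => i _.
  by apply/matrixP => a c; rewrite !mxE /= /horner_eval hornerM hornerXn hornerC.
apply: contraLR geo; rewrite -unitfE -unitmxE -unitmx_tr -row_free_unit -kermx_eq0.
by rewrite /geo_mult => /eqP ->; rewrite mxrank0.
Qed.

End Multiplicity.

(** * Multiplicities, parity and the normalised standard pair *)

Theorem theorem3p8 (R : realType) (n k : nat) (hn : (1 <= n)%N) (hk : (2 <= k)%N)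
    (A : 'I_k.+1 -> 'M[R]_n)
    (hskew : T_skew_symmetric A)
    (hlead : A ord_max \in unitmx)
    (hsemi : semisimple_eigenvalues A)
    (r s : nat) (hrs : (r <= s)%N)
    (n_ : 'I_s -> nat) (hn_ : forall j, (0 < n_ j)%N)
    (alpha beta : 'I_s -> R)
    (hbeta : forall j : 'I_s, (j < r)%N -> beta j != 0)
    (hdisj : forall i j : 'I_s, i != j -> forall z : R[i],
       ~~ (spectrum (J_block (i < r)%N (n_ i) (alpha i) (beta i)) z
           && spectrum (J_block (j < r)%N (n_ j) (alpha j) (beta j)) z))
    (hdim : (\sum_(j < s) bdim (j < r)%N (n_ j) = k * n)%N)
    (X : 'M[R]_(n, k * n)) (J : 'M[R]_(k * n))
    (hJ : J = castmx (hdim, hdim)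
       (\mxdiag_(j < s) J_block (j < r)%N (n_ j) (alpha j) (beta j)))
    (hXJ : standard_pair A X J) :
  exists m : 'I_s -> nat,
    (forall j : 'I_s,
       [/\ alg_mult A (Complex (alpha j) (if (j < r)%N then beta j else 0)) = n_ j,
           n_ j = (2 * m j)%N & (0 < m j)%N])
    /\ exists (Xt : 'M[R]_(n, k * n)) (e : forall j : 'I_s, 'I_(m j) -> bool)
              (hdimG : (\sum_(j < s) bdim (j < r)%N (m j + m j) = k * n)%N),
       [/\ standard_pair A Xt J,
           S_JTmm J (pair_Gamma A Xt J) &
           pair_Gamma A Xt J = castmx (hdimG, hdimG)
             (\mxdiag_(j < s) Gamma_block R (j < r)%N (e j))].
Proof.
have [Xu PXJ] := hXJ; have k_gt0 : (0 < k)%N by exact: ltnW.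
have [Gt GJ] := pair_Gamma_S hskew hlead hXJ.
have Gu := pair_Gamma_unit hlead Xu.
have alg j : alg_mult A (Complex (alpha j) (if (j < r)%N then beta j else 0)) = n_ j.
  have geo := geo_mult_standard_pair
    (Complex (alpha j) (bim (j < r)%N (beta j))) k_gt0 hlead hXJ.
  rewrite hJ kermx_mxdiag_J_block // in geo.
  by rewrite hsemi //; apply: eigenvalue_geo_mult; rewrite geo.
have even j : ~~ odd (n_ j).
  move: (pair_Gamma A X J) Gt GJ Gu => S; rewrite hJ => St SJ Su.
  exact: (@blocks_even _ _ (fun j : 'I_s => (j < r)%N) _ _ _ hn_ hbeta hdisj _ _ _ St Su SJ).
(* An equality of functions is needed so that substituting [n_] turns the block sizes into
   [m j + m j] inside the dependent types. *)
have [m mE] : exists m, n_ = fun j => (m j + m j)%N.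
  exists (fun j => (n_ j)./2); apply: boolp.funext => j.
  by rewrite addnn even_halfK.
subst n_.
have [T [Tu TJ TG]] : exists T, [/\ T \in unitmx, T *m J = J *m T
    & T *m pair_Gamma A X J *m T^T = castmx (hdim, hdim)
        (\mxdiag_(j < s) Gamma_block R (j < r)%N (fun _ : 'I_(m j) => false))].
  move: (pair_Gamma A X J) Gt GJ Gu => S; rewrite hJ => St SJ Su.
  exact: (@blocks_normal_form _ _ (fun j : 'I_s => (j < r)%N) _ _ _ _ _ _
    hn_ hbeta hdisj St Su SJ).
exists m; split=> [j|].
  by split; [exact: alg | rewrite mul2n -addnn | have := hn_ j; rewrite addn_gt0 orbb].
have VJ := commute_invmx Tu TJ.
have pairV : standard_pair A (X *m invmx T) J.
  by apply: standard_pair_mulr; rewrite ?unitmx_inv.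
(* All signs are [+1], and after the substitution [hdim] itself is the required size equation. *)
exists (X *m invmx T), (fun j _ => false), hdim; split=> //.
  exact: pair_Gamma_S.
by rewrite pair_Gamma_congr.
Qed.
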